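(* Let $S$ be an atomic monoid, $P \subset S$ a set of representatives (up to associates) of the set of primes of $S$, and $T$ the set of all $a \in S$ such that $p \nmid a$ for all $p \in P$. Suppose that $T = \coprod_{i \in I} T_i$ for some family of monoids $(T_i)_{i\in I}$, that $T \ne T^{\times}$, and that there is an $i^* \in I$ such that $T_{i^*}$ has a generic presentation and $\mathsf t (T_{i^*}) = \mathsf t (T)$. Then $\mathsf c (S) = \omega (S) = \mathsf t (S)$.
   Context: $\mathbb N$ denotes the positive integers, $\mathbb N_0=\mathbb N\cup\{0\}$; suprema are taken in $\mathbb N_0\cup\{\infty\}$ (with $\sup\emptyset=0$). A monoid is a commutative, cancellative semigroup with unit element; $\coprod$ denotes the coproduct (direct sum) of monoids. $S^\times$ is the group of units, $\mathcal A(S)$ the set of atoms, $S_{\mathrm{red}}=\{aS^\times\mid a\in S\}$ the associated reduced monoid. $\mathsf Z(S)=\mathcal F(\mathcal A(S_{\mathrm{red}}))$ is the free abelian monoid with basis $\mathcal A(S_{\mathrm{red}})$, $|z|$ the length and $\mathrm{supp}(z)$ the set of basis elements occurring in $z\in\mathsf Z(S)$; $\pi\colon\mathsf Z(S)\to S_{\mathrm{red}}$ is the homomorphism with $\pi(u)=u$ for $u\in\mathcal A(S_{\mathrm{red}})$. For $a\in S$, $\mathsf Z(a)=\{z\mid\pi(z)=aS^\times\}$. $S$ is atomic if $\mathsf Z(a)\ne\emptyset$ for all $a\in S$. (The submonoid $T$ is again atomic.) The monoid of relations is $\sim_S\,=\{(x,y)\in\mathsf Z(S)\times\mathsf Z(S)\mid\pi(x)=\pi(y)\}$.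 A subset $\sigma\subset\,\sim_S$ is a presentation of $S$ if the congruence on $\mathsf Z(S)$ generated by $\sigma$ equals $\sim_S$; it is minimal if no proper subset of $\sigma$ generates $\sim_S$; it is generic if it is a minimal presentation and $\mathrm{supp}(xy)=\mathcal A(S_{\mathrm{red}})$ for all $(x,y)\in\sigma$. The distance of $z,z'\in\mathsf Z(S)$ is $\mathsf d(z,z')=\max\{|z\gcd(z,z')^{-1}|,|z'\gcd(z,z')^{-1}|\}$. Catenary degree: $\mathsf c(a)$ is the smallest $N\in\mathbb N_0\cup\{\infty\}$ such that for any $z,z'\in\mathsf Z(a)$ there are $z=z_0,z_1,\dots,z_k=z'$ in $\mathsf Z(a)$ with $\mathsf d(z_{i-1},z_i)\le N$ for all $i\in[1,k]$; $\mathsf c(S)=\sup\{\mathsf c(a)\mid a\in S\}$. $\omega$-invariant: for $b\in S$, $\omega(S,b)$ is the smallest $N\in\mathbb N_0\cup\{\infty\}$ such that for all $n\in\mathbb N$ and $a_1,\dots,a_n\in S$ with $b\mid a_1\cdots a_n$ there is $\Omega\subset[1,n]$ with $|\Omega|\le N$ and $b\mid\prod_{\nu\in\Omega}a_\nu$; $\omega(S)=\sup\{\omega(S,u)\mid u\in\mathcal A(S)\}$. Tame degree: for $a\in S$ and $u\in\mathcal A(S_{\mathrm{red}})$, $\mathsf t(a,u)$ is the smallest $N\in\mathbb N_0\cup\{\infty\}$ such that: if $\mathsf Z(a)\cap u\mathsf Z(S)\ne\emptyset$ and $z\in\mathsf Z(a)$, then there is $z'\in\mathsf Z(a)\cap u\mathsf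 Z(S)$ with $\mathsf d(z,z')\le N$; $\mathsf t(S)=\sup\{\mathsf t(a,u)\mid a\in S,\,u\in\mathcal A(S_{\mathrm{red}})\}$. *)

(* Defs.v *)
From HB Require Import structures.
From mathcomp Require Import all_boot all_algebra.
From mathcomp Require Import finmap multiset.
From mathcomp Require Import boolp classical_sets cardinality.

Set Implicit Arguments.
Unset Strict Implicit.
Unset Printing Implicit Defensive.

Import GRing.Theory.

Local Open Scope quotient_scope.
Local Open Scope mset_scope.
Local Open Scope classical_set_scope.
Local Open Scope ring_scope.

(* Commutative monoids are [nmodType]s and are written additively: the product
   ab is [a + b], the unit element is [0], and b | a means a = b + c for some c.
   Cancellation is a separate predicate because [nmodType] does not include it. *)

Definition cancellative (S : nmodType) : Prop := right_injective (@GRing.add S).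

(* N_0 together with an infinite element *)
Variant enat := Fin of nat | Infty.

Definition enat_le (x y : enat) : Prop :=
  match x, y with
  | Fin m, Fin n => (m <= n)%N
  | _, Infty => True
  | Infty, Fin _ => False
  end.

(* Every [Q] to which [least] is applied below holds at [Infty], so the value
   [Infty] returned when [Q] has no finite solution is the least one. *)
Definition least (Q : enat -> Prop) : enat :=
  match pselect (exists n, `[< Q (Fin n) >]) with
  | left exQ => Fin (ex_minn exQ)
  | right _ => Infty
  end.

Definition esup (A : set enat) : enat :=
  least (fun N => forall x, A x -> enat_le x N).

Section Divisibility.
Variable S : nmodType.
Implicit Types a b p u : S.

Definition divides b a : Prop := exists c, a = b + c.

Definition units : set S := [set u | exists v, u + v = 0].

Definition associated a b : Prop := exists2 u, units u & b = a + u.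

Definition atom a : Prop :=
  ~ units a /\ forall b c, a = b + c -> units b \/ units c.

Definition prime_elt p : Prop :=
  ~ units p /\ forall a b, divides p (a + b) -> divides p a \/ divides p b.

Definition prime_representatives (P : set S) : Prop :=
  (forall p, P p -> prime_elt p) /\
  (forall q, prime_elt q -> exists! p, P p /\ associated p q).

End Divisibility.

Section Reduced.
Variable S : nmodType.
Implicit Types a b c : S.

Definition assoc : rel S := fun a b => `[< associated a b >].

Lemma assoc_refl : reflexive assoc.
Proof.
by move=> a; apply/asboolP; exists 0; rewrite ?addr0 //; exists 0; rewrite addr0.
Qed.

Lemma assoc_sym : symmetric assoc.
Proof.
suff H a b : assoc a b -> assoc b a by move=> a b; apply/idP/idP; apply: H.
move=> /asboolP[u [v uv0] ->]; apply/asboolP; exists v.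
  by exists u; rewrite addrC.
by rewrite -addrA uv0 addr0.
Qed.

Lemma assoc_trans : transitive assoc.
Proof.
move=> b a c /asboolP[u [u' uu'] ->] /asboolP[v [v' vv'] ->].
apply/asboolP; exists (u + v); last by rewrite addrA.
by exists (u' + v'); rewrite addrACA uu' vv' addr0.
Qed.

Canonical assoc_equiv := EquivRel assoc assoc_refl assoc_sym assoc_trans.

(* S_red: the monoid of cosets aS^x, as the quotient by associatedness *)
Definition reduced : Type := {eq_quot assoc}.

HB.instance Definition _ := EqQuotient.on reduced.
HB.instance Definition _ := Choice.on reduced.

Definition coset a : reduced := \pi_reduced a.

Lemma cosetP a b : coset a = coset b <-> associated a b.
Proof. by split=> [/eqmodP/asboolP|ab]; last by apply/eqmodP/asboolP. Qed.

Definition reduced_add (A B : reduced) : reduced := coset (repr A + repr B).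

Lemma coset_add a b : coset (a + b) = reduced_add (coset a) (coset b).
Proof.
have repr_coset c : associated c (repr (coset c)).
  by apply/cosetP; rewrite /coset reprK.
rewrite /reduced_add; have [[u [u' uu'] ->] [v [v' vv'] ->]] := (repr_coset a, repr_coset b).
apply/cosetP; exists (u + v); last by rewrite addrACA.
by exists (u' + v'); rewrite addrACA uu' vv' addr0.
Qed.

Lemma coset_repr (A : reduced) : coset (repr A) = A.
Proof. exact: reprK. Qed.

Lemma reduced_addA : associative reduced_add.
Proof.
move=> A B C; rewrite -(coset_repr A) -(coset_repr B) -(coset_repr C).
by rewrite -!coset_add addrA.
Qed.

Lemma reduced_addC : commutative reduced_add.
Proof. by move=> A B; rewrite /reduced_add addrC. Qed.

Lemma reduced_add0 : left_id (coset 0) reduced_add.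
Proof. by move=> A; rewrite -(coset_repr A) -coset_add add0r. Qed.

HB.instance Definition _ :=
  GRing.isNmodule.Build reduced reduced_addA reduced_addC reduced_add0.

Definition red_atom : Type := {u : reduced | `[< atom u >]}.

HB.instance Definition _ := Choice.on red_atom.

End Reduced.

Arguments coset {S} a.

(* Z(S): the free abelian monoid with basis A(S_red), realized as the finite
   multisets of atoms of S_red.  The product xy is the multiset sum, |z| is the
   number of elements counted with multiplicity, supp(z) is membership and the
   gcd is the multiset intersection (minimum of the exponents). *)
Notation factorization S := {mset (red_atom S)}.

Section Factorizations.
Variable S : nmodType.
Implicit Types (a b : S) (u : red_atom S) (x y z : factorization S).

Definition fact_prod z : reduced S := \sum_(u <- z) val u.

Definition factorizations a : set (factorization S) :=
  [set z | fact_prod z = coset a].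

Definition atomic : Prop := forall a, factorizations a !=set0.

Definition dist z z' : nat :=
  maxn (size (z `\` (z `&` z'))%mset) (size (z' `\` (z `&` z'))%mset).

Definition relations : set (factorization S * factorization S) :=
  [set xy | fact_prod xy.1 = fact_prod xy.2].

Definition congruence (E : set (factorization S * factorization S)) : Prop :=
  [/\ forall x, E (x, x),
      forall x y, E (x, y) -> E (y, x),
      forall x y z, E (x, y) -> E (y, z) -> E (x, z) &
      forall x y z, E (x, y) -> E (z `+` x, z `+` y)%mset].

Definition generates (s : set (factorization S * factorization S)) : Prop :=
  smallest congruence s = relations.

Definition presentation (s : set (factorization S * factorization S)) : Prop :=
  s `<=` relations /\ generates s.

Definition minimal_presentation
    (s : set (factorization S * factorization S)) : Prop :=
  presentation s /\ forall s', s' `<` s -> ~ generates s'.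

Definition generic_presentation
    (s : set (factorization S * factorization S)) : Prop :=
  minimal_presentation s /\
  forall xy, s xy -> forall u, u \in (xy.1 `+` xy.2)%mset.

Definition has_generic_presentation : Prop :=
  exists s, generic_presentation s.

Definition chain_connected a (N : enat) z z' : Prop :=
  exists (k : nat) (w : nat -> factorization S),
    [/\ w 0%N = z, w k = z',
        forall i, (i <= k)%N -> factorizations a (w i) &
        forall i, (i < k)%N -> enat_le (Fin (dist (w i) (w i.+1))) N].

Definition catenary_degree_at a : enat :=
  least (fun N => forall z z', factorizations a z -> factorizations a z' ->
    chain_connected a N z z').

Definition catenary_degree : enat :=
  esup [set catenary_degree_at a | a in [set: S]].

Definition omega_at b : enat :=
  least (fun N => forall (n : nat) (a : 'I_n -> S), (0 < n)%N ->
    divides b (\sum_i a i) ->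
    exists2 Om : {set 'I_n}, enat_le (Fin #|Om|) N &
      divides b (\sum_(i in Om) a i)).

Definition omega : enat := esup [set omega_at u | u in [set u : S | atom u]].

(* u Z(S) *)
Definition multiples u : set (factorization S) :=
  [set z | exists y, z = ([mset u] `+` y)%mset].

Definition tame_degree_at a u : enat :=
  least (fun N => factorizations a `&` multiples u !=set0 ->
    forall z, factorizations a z ->
    exists2 z', (factorizations a `&` multiples u) z' &
      enat_le (Fin (dist z z')) N).

Definition tame_degree : enat :=
  esup [set x | exists a u, x = tame_degree_at a u].

End Factorizations.

Arguments atomic S : clear implicits.
Arguments has_generic_presentation S : clear implicits.
Arguments catenary_degree S : clear implicits.
Arguments omega S : clear implicits.
Arguments tame_degree S : clear implicits.
Arguments units S : clear implicits.

(* The submonoid of the elements divisible by no p in P.  That it is closed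
   under the operation uses that the elements of P are prime, so the type
   carries the proof [hP]. *)
Section PrimeFree.
Variables (S : nmodType) (P : set S) (hP : prime_representatives P).

Definition prime_free_pred of prime_representatives P : {pred S} :=
  fun a => `[< forall p, P p -> ~ divides p a >].

Lemma prime_free_closed : addr_closed (prime_free_pred hP).
Proof.
split=> [|a b /asboolP Ha /asboolP Hb].
  apply/asboolP=> p /(proj1 hP)[pNu _] [c pc0].
  by apply: pNu; exists c; rewrite pc0.
apply/asboolP=> p Pp /(proj2 (proj1 hP p Pp))[].
  exact: Ha.
exact: Hb.
Qed.

HB.instance Definition _ :=
  GRing.isAddClosed.Build S (prime_free_pred hP) prime_free_closed.

Record prime_free : Type :=
  PrimeFree { prime_free_val :> S;
              prime_free_valP : prime_free_pred hP prime_free_val }.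

HB.instance Definition _ := [isSub for prime_free_val].
HB.instance Definition _ := [Choice of prime_free by <:].
HB.instance Definition _ :=
  GRing.SubChoice_isSubNmodule.Build S (prime_free_pred hP) prime_free
    prime_free_closed.

End PrimeFree.

(* The coproduct of a family of monoids: its finitely supported elements *)
Definition coproduct (I : Type) (T_ : I -> nmodType) : set (forall i, T_ i) :=
  [set f | finite_set [set i | f i <> 0]].

Arguments coproduct {I} T_.

(* [T] is isomorphic to the coproduct, with its componentwise operation. *)
Definition is_coproduct (T : nmodType) (I : Type) (T_ : I -> nmodType) : Prop :=
  exists phi : T -> forall i, T_ i,
    [/\ forall i, phi 0 i = 0,
        forall a b i, phi (a + b) i = phi a i + phi b i,
        injective phi &
        range phi = coproduct T_].

(* Main.v *)
(* Multiplicative notation.  One proves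
     t(S) <= t(T) = t(T_i* ) <= c(T_i* ) <= c(S) <= omega(S) <= t(S).
   - t(S) <= t(T): S_red is the product of T_red and a free monoid on primes, so
     only the prime-free part of a factorization has to be moved.
   - t(T_i* ) <= c(T_i* ): by minimality of a generic presentation, the two sides
     of a relation (x, y) are coprime and are the only factorizations of pi(x), so
     max(|x|, |y|) = d(x, y) <= c.  If u divides pi(z) and u is not in z, some
     relation (x, y) applies to z, as z is not the only factorization of pi(z); as
     u is not in x it is in y, so one step reaches a factorization containing u.
   - c(T_i* ) <= c(S): T_i* is divisor-closed in S up to units.
   - c(S) <= omega(S) = N: each factorization of an element has length at most N
     times that of any other, which allows induction on the maximal length.  If
     |z| > N and v is in z', then v divides a product of at most N factors of z;
     exchanging these yields a factorization sharing an atom with z and with z'.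
   - omega(S) <= t(S): the factors removed from z by a tame move that introduces
     u have a product divisible by u.  An atom that is already present costs one
     factor, and t(S) >= 1 since T has an atom, which is not prime in S. *)
Require Import Defs.
From HB Require Import structures.
From mathcomp Require Import all_boot all_algebra.
From mathcomp Require Import finmap multiset.
From mathcomp Require Import boolp classical_sets cardinality.
From mathcomp Require Import zify.
(* Again, as all_boot shadows fact_prod. *)
Require Import Defs.

Set Implicit Arguments.
Unset Strict Implicit.
Unset Printing Implicit Defensive.

Import GRing.Theory.

Local Open Scope classical_set_scope.
Local Open Scope ring_scope.
Local Open Scope mset_scope.

(** * The order on [enat], and how [least] and [esup] relate to it *)

Lemma enat_le_trans x y z : enat_le x y -> enat_le y z -> enat_le x z.
Proof. by case: x y z => [m|] [n|] [p|] //=; apply: leq_trans. Qed.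

Lemma enat_le_anti x y : enat_le x y -> enat_le y x -> x = y.
Proof.
by case: x y => [m|] [n|] //= mn nm; congr Fin; apply/eqP; rewrite eqn_leq mn.
Qed.

Lemma enat_le_Infty x : enat_le x Infty.
Proof. by case: x. Qed.

(** For an upward closed [Q] that holds at [Infty], a bound on [least Q] carries the same
    information as [Q] itself. Each invariant is handled through this equivalence only. *)
Lemma least_leP (Q : enat -> Prop) :
  (forall m n, enat_le m n -> Q m -> Q n) -> Q Infty ->
  forall N, enat_le (least Q) N <-> Q N.
Proof.
move=> Qup Qinf N; rewrite /least; case: pselect => [exQ|nexQ].
  case: ex_minnP => m /asboolP Qm min_m; split; first by move/Qup; apply.
  by case: N => // n Qn; apply: min_m; apply/asboolP.
split; first by case: N.
by case: N => // n Qn; case: nexQ; exists n; apply/asboolP.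
Qed.

Lemma esup_leP (A : set enat) N :
  enat_le (esup A) N <-> forall x, A x -> enat_le x N.
Proof.
apply: (@least_leP (fun N => forall x, A x -> enat_le x N)) => [m n mn Am x Ax|x _].
  exact: enat_le_trans (Am x Ax) mn.
exact: enat_le_Infty.
Qed.

(** * Finite multisets *)

Section MsetExtra.
Variable K : choiceType.
Implicit Types (A B C : {mset K}) (s t : seq K).
Local Open Scope nat_scope.

HB.instance Definition _ := Monoid.isComLaw.Build {mset K} mset0 msetD
  (@msetDA K) (@msetDC K) (@mset0D K).

Lemma perm_msetD A B : perm_eq (A `+` B)%mset (A ++ B).
Proof.
by apply/allP => a _ /=; rewrite count_cat !count_mem_mset msetE2.
Qed.

Lemma size_msetD A B : size (A `+` B)%mset = size A + size B.
Proof. by rewrite (perm_size (perm_msetD A B)) size_cat. Qed.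

Lemma size_mset1 (a : K) : size [mset a]%mset = 1.
Proof. by rewrite enum_msetn. Qed.

Lemma seq_mset_cat s t : seq_mset (s ++ t) = (seq_mset s `+` seq_mset t)%mset.
Proof. by apply/msetP => a; rewrite msetE2 !mset_seqE count_cat. Qed.

Lemma mem_seq_mset a s : (a \in seq_mset s) = (a \in s).
Proof. by rewrite in_mset mset_seqE -has_count has_pred1. Qed.

Lemma big_msetDE n (z : 'I_n -> {mset K}) (P : pred 'I_n) a :
  (\big[msetD/mset0]_(i | P i) z i)%mset a = \sum_(i | P i) z i a.
Proof.
apply: (big_morph (fun z : {mset K} => z a)); last exact: mset0E.
by move=> A B; rewrite msetE2.
Qed.

(** Induction on the size of [A]: some [z j] contains a given [v] in [A]; one copy of [v] is removed
    from both, and [j] joins the index set of the smaller problem. *)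
Lemma msubset_big_cover n (z : 'I_n -> {mset K}) A :
  (A `<=` \big[msetD/mset0]_i z i)%mset ->
  exists2 Om : {set 'I_n}, #|Om| <= size A &
    (A `<=` \big[msetD/mset0]_(i in Om) z i)%mset.
Proof.
elim: {A}(size A) {-2}A (erefl (size A)) z => [|m IHm] A sA z Az.
  exists finset.set0; first by rewrite cards0.
  by move/eqP: sA; rewrite size_mset_eq0 => /eqP->; exact: msub0set.
have [A0|[v vA]] := mset_0Vmem A; first by move: sA; rewrite A0 size_mset0.
have [j vzj] : exists j, v \in z j.
  have := msubsetP Az v; rewrite big_msetDE => Avz; apply/existsP.
  apply: contraLR vA => /existsPn nz; rewrite -mset_eq0 -leqn0.
  by apply: leq_trans Avz _; rewrite big1 // => i _; apply/eqP; rewrite mset_eq0.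
pose z' i : {mset K} := if i == j then (z j `\ v)%mset else z i.
have zE (Q : pred 'I_n) b : Q j ->
    \sum_(i | Q i) z i b = (b == v) + \sum_(i | Q i) z' i b.
  move=> Qj; rewrite (bigD1 j) //= [in RHS](bigD1 j) //= /z' eqxx msetB1E addnA.
  congr addn.
    rewrite subnKC //; case: eqP => [->|] //; by rewrite mset_gt0.
  by apply: eq_bigr => i /andP[_ /negPf->].
have sA' : size (A `\ v)%mset = m.
  have := sA; rewrite -{1}(msetB1K vA) size_msetD size_mset1; lia.
have [|Om sOm AOm] := IHm _ sA' z'.
  apply/msubsetP => b; have := msubsetP Az b; rewrite !big_msetDE msetB1E.
  by rewrite (zE predT) // leq_subLR.
exists (j |: Om)%SET.
  by rewrite sA cardsU1 -(add1n m) leq_add ?leq_b1 -?sA'.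
apply/msubsetP => b; rewrite big_msetDE (zE (mem (j |: Om)%SET)) //=; last exact: finset.setU11.
have := msubsetP AOm b; rewrite big_msetDE msetB1E leq_subLR => /leq_trans; apply.
(* The induction may have chosen [j] already, since [z' j] can still contribute other elements. *)
rewrite leq_add2l; have [jOm|jOm] := boolP (j \in Om).
  suff -> : (j |: Om)%SET = Om by [].
  by apply/finset.setUidPr; rewrite finset.sub1set.
by rewrite big_setU1 //= leq_addl.
Qed.

End MsetExtra.

(** * Passage between a monoid and its reduced monoid *)

Section ReducedTheory.
Variable S : nmodType.
Implicit Types (a b p : S) (A B C : reduced S).

Lemma cosetD a b : coset (a + b) = coset a + coset b.
Proof. exact: coset_add. Qed.

Lemma coset0 : coset 0 = 0 :> reduced S.
Proof. by []. Qed.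

Lemma coset_sum (J : finType) (Q : pred J) (a : J -> S) :
  coset (\sum_(j | Q j) a j) = \sum_(j | Q j) coset (a j).
Proof. exact: (big_morph _ cosetD coset0). Qed.

Lemma units_reduced A : units (reduced S) A -> A = 0.
Proof.
rewrite -(coset_repr A) => -[B]; rewrite -(coset_repr B) -cosetD -coset0.
move=> /cosetP[u [u' uu'] E]; apply/cosetP; exists (repr B + u) => //.
- by exists (repr A); rewrite [LHS]addrC addrA -E.
- by rewrite addrA -E.
Qed.

Lemma units0 : units (reduced S) 0.
Proof. by exists 0; rewrite addr0. Qed.

Lemma reduced_addI0 A B : A + B = 0 -> A = 0.
Proof. by move=> AB0; apply: units_reduced; exists B. Qed.

Lemma coset_eq0 a : (coset a = 0) <-> units S a.
Proof.
rewrite -coset0; split=> [/cosetP[u _ /esym au]|[b ab0]]; first by exists u.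
by apply/cosetP; exists b => //; exists a; rewrite addrC.
Qed.

Lemma cancel_reduced : cancellative S -> cancellative (reduced S).
Proof.
move=> cS A B C; rewrite -(coset_repr A) -(coset_repr B) -(coset_repr C) -!cosetD.
move=> /cosetP[u uu]; rewrite -addrA => /cS E; apply/cosetP.
by exists u.
Qed.

Lemma divides_coset a b : divides (coset a) (coset b) <-> divides a b.
Proof.
split=> [[C]|[c ->]]; last by exists (coset c); rewrite cosetD.
rewrite -(coset_repr C) -cosetD => /esym /cosetP[u _ ->].
by exists (repr C + u); rewrite addrA.
Qed.

Lemma atom_coset a : atom (coset a) <-> atom a.
Proof.
split=> -[Nu aP]; split.
- by move/coset_eq0 => a0; apply: Nu; rewrite a0; exact: units0.
- move=> b c abc; have [|/units_reduced|/units_reduced] := aP (coset b) (coset c).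
  + by rewrite abc cosetD.
  + by left; apply/coset_eq0.
  + by right; apply/coset_eq0.
- by move/units_reduced/coset_eq0.
- move=> B C; rewrite -(coset_repr B) -(coset_repr C) -cosetD.
  move=> /esym /cosetP[u _ aE].
  have [|/coset_eq0 ->|/coset_eq0] := aP (repr B) (repr C + u).
  + by rewrite addrA.
  + by left; exact: units0.
  + by rewrite cosetD => /reduced_addI0 ->; right; exact: units0.
Qed.

Lemma prime_coset p : prime_elt (coset p) <-> prime_elt p.
Proof.
split=> -[Nu pP]; split.
- by move/coset_eq0 => p0; apply: Nu; rewrite p0; exact: units0.
- by move=> a b; rewrite -!divides_coset cosetD; exact: pP.
- by move/units_reduced/coset_eq0.
- move=> A B; rewrite -(coset_repr A) -(coset_repr B) -cosetD !divides_coset.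
  exact: pP.
Qed.

End ReducedTheory.

(** * Factorizations, distances and upper bounds for the three invariants *)

Section FactorizationTheory.
Variable S : nmodType.
Implicit Types (a b : S) (u v : red_atom S) (x y z w : factorization S).
Implicit Types (A B C : reduced S).

Lemma red_atomP u : atom (val u).
Proof. exact/asboolP/(valP u). Qed.

Lemma fact_prodD x y : fact_prod (x `+` y) = fact_prod x + fact_prod y.
Proof. by rewrite /fact_prod (perm_big _ (perm_msetD x y)) big_cat. Qed.

Lemma fact_prod0 : fact_prod (mset0 : factorization S) = 0.
Proof. exact: big_mset0. Qed.

Lemma fact_prod1 u : fact_prod [mset u] = val u.
Proof. by rewrite /fact_prod big_msetn /= . Qed.

Lemma fact_prod_seq_mset (s : seq (red_atom S)) :
  fact_prod (seq_mset s) = \sum_(u <- s) val u.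
Proof. exact: perm_big (perm_eq_seq_mset s). Qed.

Lemma fact_prod_big n (z : 'I_n -> factorization S) (Q : pred 'I_n) :
  fact_prod (\big[msetD/mset0]_(i | Q i) z i) = \sum_(i | Q i) fact_prod (z i).
Proof. exact: (big_morph _ fact_prodD fact_prod0). Qed.

Lemma fact_prod_eq0 z : fact_prod z = 0 -> z = mset0.
Proof.
have [//|[u uz]] := mset_0Vmem z.
rewrite -(msetB1K uz) fact_prodD fact_prod1 => /reduced_addI0 u0.
by have [] := red_atomP u; rewrite u0; case; exact: units0.
Qed.

Lemma mem_divides u z : u \in z -> divides (val u) (fact_prod z).
Proof.
by move=> uz; exists (fact_prod (z `\ u)); rewrite -fact_prod1 -fact_prodD msetB1K.
Qed.

Lemma msubset_divides x z : (x `<=` z) -> divides (fact_prod x) (fact_prod z).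
Proof.
by move=> xz; exists (fact_prod (z `\` x)); rewrite -fact_prodD msetBDKC.
Qed.

Lemma divides_trans (M : nmodType) (a b c : M) :
  divides a b -> divides b c -> divides a c.
Proof. by move=> [x ->] [y ->]; exists (x + y); rewrite addrA. Qed.

Lemma red_atom_divides u v : divides (val u) (val v) -> u = v.
Proof.
move=> [C vE]; have [_ /(_ _ _ vE)[uu|/units_reduced C0]] := red_atomP v.
  by have [/(_ uu)] := red_atomP u.
by apply: val_inj; rewrite vE C0 addr0.
Qed.

Lemma prime_divides_fact_prod A z :
  prime_elt A -> divides A (fact_prod z) -> exists2 v, v \in z & divides A (val v).
Proof.
move=> [ANu Ap]; suff H (s : seq (red_atom S)) : divides A (\sum_(u <- s) val u) ->
    exists2 v, v \in s & divides A (val v) by exact: H.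
elim: s => [|v s IHs].
  by rewrite big_nil => -[C /esym AC0]; case: ANu; exists C.
rewrite big_cons => /Ap[Av|/IHs[w ws Aw]].
  by exists v; rewrite ?mem_head.
by exists w; rewrite // inE ws orbT.
Qed.

Lemma atomic_reduced : atomic S -> forall A, exists z, fact_prod z = A.
Proof. by move=> atS A; rewrite -(coset_repr A); exact: atS. Qed.

Lemma dist_msetDl w z z' : dist (w `+` z) (w `+` z') = dist z z'.
Proof. by rewrite /dist -msetDIr !msetBDl. Qed.

Lemma dist_coprime z z' :
  (z `&` z') = mset0 -> dist z z' = maxn (size z) (size z').
Proof. by rewrite /dist => ->; rewrite !msetB0. Qed.

Lemma distxx z : dist z z = 0%N.
Proof. by rewrite /dist msetIid msetBxx size_mset0. Qed.

Lemma dist_le z z' : (dist z z' <= maxn (size z) (size z'))%N.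
Proof.
have sB (A B : factorization S) : (size (A `\` B) <= size A)%N.
  by rewrite -[in leqRHS](msetBDK (msubsetDl A B)) size_msetD leq_addl.
by rewrite /dist geq_max !leq_max !sB orbT.
Qed.

(** Splitting off the gcd [g] reduces distance computations to coprime multisets, by [dist_msetDl]
    and [dist_coprime]. *)
Lemma msetI_split (K : choiceType) (z z' : {mset K}) : exists g x y : {mset K},
  [/\ z = (g `+` x), z' = (g `+` y) & (x `&` y) = mset0].
Proof.
exists (z `&` z'), (z `\` (z `&` z')), (z' `\` (z `&` z')).
split; [by rewrite msetBDKC ?msubsetIl|by rewrite msetBDKC ?msubsetIr|].
by apply/msetP => a; rewrite !msetE2 mset0E; lia.
Qed.

Lemma catenary_leP N : enat_le (catenary_degree S) N <->
  forall a z z', factorizations a z -> factorizations a z' ->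
    chain_connected a N z z'.
Proof.
have catP a M : enat_le (catenary_degree_at a) M <->
    (forall z z', factorizations a z -> factorizations a z' ->
       chain_connected a M z z').
  apply: (@least_leP (fun N => forall z z', factorizations a z ->
      factorizations a z' -> chain_connected a N z z')) => [m n mn cm z z' az az'|z z' az az'].
    have [k [w [w0 wk wf wd]]] := cm z z' az az'; exists k, w; split=> // i ik.
    exact: enat_le_trans (wd i ik) mn.
  exists 1%N, (fun i => if i is 0 then z else z'); split=> //; by case.
split=> [/esup_leP cN a|cN]; first by apply/catP/cN; exists a.
by apply/esup_leP => _ [a _ <-]; apply/catP/cN.
Qed.

Lemma omega_leP N : enat_le (omega S) N <->
  forall (u : S) n (a : 'I_n -> S), atom u -> (0 < n)%N ->
    divides u (\sum_i a i) ->
    exists2 Om : {set 'I_n}, enat_le (Fin #|Om|) N & divides u (\sum_(i in Om) a i).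
Proof.
have omP b M : enat_le (omega_at b) M <->
    (forall (n : nat) (a : 'I_n -> S), (0 < n)%N -> divides b (\sum_i a i) ->
      exists2 Om : {set 'I_n}, enat_le (Fin #|Om|) M &
        divides b (\sum_(i in Om) a i)).
  apply: (@least_leP (fun M => forall (n : nat) (a : 'I_n -> S), (0 < n)%N ->
      divides b (\sum_i a i) ->
      exists2 Om : {set 'I_n}, enat_le (Fin #|Om|) M &
        divides b (\sum_(i in Om) a i))) => [m n mn om k a k0 ba|n a n0 ba].
    by have [Om sOm dOm] := om k a k0 ba; exists Om => //; exact: enat_le_trans mn.
  exists [set: 'I_n]%SET; first exact: enat_le_Infty.
  by rewrite (eq_bigl predT) // => i; rewrite finset.in_setT.
split=> [/esup_leP oN u n a au|oN].
  by apply: (proj1 (omP u N)); apply: oN; exists u.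
by apply/esup_leP => _ [u au <-]; apply/omP => n a; exact: oN.
Qed.

(** Quantifies over factorizations instead of elements: [a] is recovered as a representative of
    [fact_prod z], and a multiple of [u] is given by its cofactor [y]. *)
Lemma tame_leP N : enat_le (tame_degree S) N <->
  forall u z y, fact_prod z = fact_prod ([mset u] `+` y) ->
    exists2 y', fact_prod ([mset u] `+` y') = fact_prod z &
      enat_le (Fin (dist z ([mset u] `+` y'))) N.
Proof.
have tP a u M : enat_le (tame_degree_at a u) M <->
    ((factorizations a `&` multiples u)%classic !=set0 -> forall z, factorizations a z ->
      exists2 z', (factorizations a `&` multiples u)%classic z' &
        enat_le (Fin (dist z z')) M).
  apply: (@least_leP (fun M => (factorizations a `&` multiples u)%classic !=set0 ->
      forall z, factorizations a z ->
      exists2 z', (factorizations a `&` multiples u)%classic z' &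
        enat_le (Fin (dist z z')) M)) => [m n mn tm ne z az|[z' z'P] z az].
    by have [z' z'P zz'] := tm ne z az; exists z' => //; exact: enat_le_trans mn.
  by exists z' => //; exact: enat_le_Infty.
split=> [/esup_leP tN u z y zE|tN].
  have /tP tP' : enat_le (tame_degree_at (repr (fact_prod z)) u) N.
    by apply: tN; exists (repr (fact_prod z)), u.
  have [||z' [z'z [y' z'E]] zz'] := tP' _ z.
  - exists ([mset u] `+` y); split; last by exists y.
    by rewrite /factorizations /= coset_repr.
  - by rewrite /factorizations /= coset_repr.
  by exists y'; rewrite -z'E // z'z coset_repr.
apply/esup_leP => _ [a [u ->]]; apply/tP => -[z1 [/= z1E [y z1y]]] z zE.
have [|y' y'z zy'] := tN u z y; first by rewrite -z1y z1E.
by exists ([mset u] `+` y') => //; split; [exact: etrans y'z zE|exists y'].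
Qed.

End FactorizationTheory.

(** * Congruences on the free monoid of factorizations *)

Section Congruences.
Variable S : nmodType.
Implicit Types (s : set (factorization S * factorization S)) (x y z w p q : factorization S).

Lemma congruence_smallest s : congruence (smallest (@congruence S) s).
Proof.
split=> [x|x y xy|x y z xy yz|x y z xy] E [cE sE].
- by case: cE.
- by case: (cE) => _ + _ _; apply; exact: xy.
- by case: (cE) => _ _ + _; apply; [apply: xy|apply: yz].
- by case: (cE) => _ _ _; apply; exact: xy.
Qed.

Lemma congruence_relations : congruence (@relations S).
Proof.
by rewrite /relations; split=> [//|x y|x y z|x y z] /= ; rewrite ?fact_prodD; move=> -> //.
Qed.

(* The syntactic congruence of {x} *)
Definition context_congruence x : set (factorization S * factorization S) :=
  [set pq | forall w, w `+` pq.1 = x <-> w `+` pq.2 = x].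

Lemma congruence_context x : congruence (context_congruence x).
Proof.
split=> [p|p q pq|p q r pq qr|p q r pq] w //=; first by rewrite -(pq w).
- by rewrite (pq w) (qr w).
- by rewrite !msetDA; exact: pq.
Qed.

(** If neither side of any pair of [s] fits inside [x], both halves of the equivalence defining
    [context_congruence x] are false on [s]. That congruence then contains the one generated by [s],
    and the empty context gives the claim. *)
Lemma generated_isolated s x y :
  (forall p q w, s (p, q) -> w `+` p <> x /\ w `+` q <> x) ->
  smallest (@congruence S) s (x, y) -> y = x.
Proof.
move=> sx sxy; have cx : (smallest (@congruence S) s `<=` context_congruence x)%classic.
  apply: smallest_sub; first exact: congruence_context.
  by move=> [p q] spq w /=; have [? ?] := sx p q w spq; split.
by have := cx _ sxy mset0; rewrite /= !mset0D => -[] /(_ erefl).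
Qed.

End Congruences.

(** * Generic presentations: the tame degree is at most the catenary degree *)

Section Generic.
Variables (S : nmodType) (S_cancel : cancellative S).
Variable s : set (factorization S * factorization S).
Hypothesis s_generic : generic_presentation s.
Implicit Types (x y z w p q : factorization S) (u : red_atom S).

Let s_rel p q : s (p, q) -> fact_prod p = fact_prod q.
Proof. by case: s_generic => -[[+ _] _ _] => /[apply]. Qed.

Let s_supp p q u : s (p, q) -> (u \in p) || (u \in q).
Proof. by move=> spq; rewrite -in_msetD; case: s_generic => _ /(_ _ spq u). Qed.

Let s_gen p q : fact_prod p = fact_prod q -> smallest (@congruence S) s (p, q).
Proof. by move=> pq; case: s_generic => -[[_ ->] _ _]. Qed.

Section OneRelation.
Variables (x y : factorization S).
Hypothesis sxy : s (x, y).

Let s' := (s `\` [set (x, y)])%classic.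
Let E' := smallest (@congruence S) s'.

Let E'_refl p : E' (p, p).
Proof. by case: (congruence_smallest s') => + _ _ _; apply. Qed.
Let E'_sym p q : E' (p, q) -> E' (q, p).
Proof. by case: (congruence_smallest s') => _ + _ _; apply. Qed.
Let E'_trans p q r : E' (p, q) -> E' (q, r) -> E' (p, r).
Proof. by case: (congruence_smallest s') => _ _ + _; apply. Qed.
Let E'_add w p q : E' (p, q) -> E' (w `+` p, w `+` q).
Proof. by case: (congruence_smallest s') => _ _ _; apply. Qed.

Let E'_rel p q : E' (p, q) -> fact_prod p = fact_prod q.
Proof.
suff : (E' `<=` @relations S)%classic by move=> /[apply].
by apply: smallest_sub; [exact: congruence_relations|move=> [a b] [/s_rel]].
Qed.

(** Otherwise [E'] would contain all of [s], so [s'] would generate every relation, against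
    minimality. *)
Let E'xy : ~ E' (x, y).
Proof.
move=> xy; have [[_ s_min] _] := s_generic.
apply: (s_min s'); first by split; [move=> pq []|move=> /(_ _ sxy) [_]; apply].
case: s_generic => -[[s_sub s_gen'] _] _.
apply/seteqP; split.
  by apply: smallest_sub; [exact: congruence_relations|move=> pq [/s_sub]].
rewrite -s_gen'; apply: smallest_sub; first exact: congruence_smallest.
move=> pq spq; have [->//|pqxy] := pselect (pq = (x, y)).
by apply: sub_gen_smallest; split.
Qed.

(* The relation (x, y) is of no use between factorizations of elements that
   pi(x) does not divide. *)
Let shared_atom p q u : fact_prod p = fact_prod x -> fact_prod q = fact_prod x ->
  u \in p -> u \in q -> E' (p, q).
Proof.
move=> px qx up uq; rewrite -(msetB1K up) -(msetB1K uq); apply: E'_add.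
have up' : val u + fact_prod (p `\ u) = fact_prod x.
  by rewrite -fact_prod1 -fact_prodD msetB1K.
have uq' : val u + fact_prod (q `\ u) = fact_prod x.
  by rewrite -fact_prod1 -fact_prodD msetB1K.
have /s_gen : fact_prod (p `\ u) = fact_prod (q `\ u).
  by apply: (cancel_reduced S_cancel (y := val u)); rewrite up'.
pose F : set (factorization S * factorization S) := [set ab |
  fact_prod ab.1 = fact_prod ab.2 /\
  (~ divides (fact_prod x) (fact_prod ab.1) -> E' ab)].
suff sF : (smallest (@congruence S) s `<=` F)%classic.
  (* If [fact_prod x] divided the product of [p] without [u], then cancelling it in [up'] would make
     [u] a unit. *)
  move=> /sF[_]; apply=> -[c pE]; have [Nu _] := red_atomP u; apply: Nu.
  exists c; apply: (cancel_reduced S_cancel (y := fact_prod x)).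
  by rewrite addr0 -[in RHS]up' pE addrCA.
apply: smallest_sub.
  split=> [a|a b [/= ab abE]|a b c [/= ab abE] [/= bc bcE]|a b c [/= ab abE]].
  - by split.
  - by split=> //= nb; apply: E'_sym; apply: abE; rewrite ab.
  - split=> /=; first by rewrite ab.
    by move=> na; apply: E'_trans (abE na) (bcE _); rewrite -ab.
  - split=> /=; first by rewrite !fact_prodD ab.
    move=> nca; apply: E'_add; apply: abE => xa; apply: nca; apply: divides_trans xa _.
    by rewrite fact_prodD; exists (fact_prod c); rewrite addrC.
move=> [a b] sab; split; first exact: s_rel.
have [[-> ->] []|nxy _] := pselect ((a, b) = (x, y)).
  by exists 0; rewrite addr0.
by apply: sub_gen_smallest.
Qed.

Let xNy : x <> y. Proof. by move=> xy; apply: E'xy; rewrite -xy; exact: E'_refl. Qed.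

Let xN0 : x <> mset0.
Proof.
move=> x0; apply: xNy; rewrite x0; apply/esym/fact_prod_eq0.
by rewrite -(s_rel sxy) x0 fact_prod0.
Qed.

Let yN0 : y <> mset0.
Proof.
move=> y0; apply: xN0; apply: fact_prod_eq0.
by rewrite (s_rel sxy) y0 fact_prod0.
Qed.

Let mem_neq0 z : z <> mset0 -> exists u, u \in z.
Proof. by have [//|[u uz] _] := mset_0Vmem z; exists u. Qed.

Let disjoint_xy u : u \in x -> u \in y -> False.
Proof. by move=> ux uy; apply: E'xy; apply: shared_atom ux uy; rewrite ?(s_rel sxy). Qed.

(** A common atom would give [E' (x, y)] by [shared_atom]. *)
Lemma generic_relation_coprime : x `&` y = mset0.
Proof.
have [//|[u]] := mset_0Vmem (x `&` y).
by rewrite in_msetI => /andP[/disjoint_xy/[apply]].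
Qed.

(* If w + p = x for a relation (p, q) other than (x, y), then w + q contains
   the support of y, which would make y equivalent to x without (x, y). *)
Let no_other_step z z' p q w : ~ E' (z, z') -> z' <> mset0 ->
    fact_prod z = fact_prod x -> fact_prod z' = fact_prod x ->
    (forall u, u \in z -> u \in z' -> False) ->
  E' (p, q) -> (forall u, (u \in p) || (u \in q)) -> w `+` p <> z.
Proof.
move=> Nzz' /mem_neq0[u uz'] zx z'x zz' Epq pq wpz; apply: Nzz'.
have Ezwq : E' (z, w `+` q) by rewrite -wpz; exact: E'_add.
apply: (E'_trans Ezwq); apply: (shared_atom (u := u)) => //.
  by rewrite -(E'_rel Ezwq).
rewrite in_msetD; case/orP: (pq u) => [up|->]; last by rewrite orbT.
by case: (zz' u) => //; rewrite -wpz in_msetD up orbT.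
Qed.

(** By [no_other_step], in both orientations, no pair of [s'] applies to [z]; hence [z] is alone in
    its class modulo [E']. *)
Let isolated z z' t : ~ E' (z, z') -> z' <> mset0 ->
    fact_prod z = fact_prod x -> fact_prod z' = fact_prod x ->
    (forall u, u \in z -> u \in z' -> False) ->
  E' (z, t) -> t = z.
Proof.
move=> Nzz' z'0 zx z'x zz'; apply: generated_isolated => p q w s'pq.
have Epq : E' (p, q) by exact: sub_gen_smallest.
have pq u : (u \in p) || (u \in q) by case: s'pq => /s_supp.
split; first exact: no_other_step Nzz' z'0 zx z'x zz' Epq pq.
apply: no_other_step Nzz' z'0 zx z'x zz' (E'_sym Epq) _ => u.
by rewrite orbC.
Qed.

(** Genericity puts any atom of [z] into [x] or [y]. By [shared_atom], [z] is then [E']-equivalent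
    to that side, whose class is a singleton by [isolated]. *)
Lemma generic_relation_factorizations z :
  fact_prod z = fact_prod x -> z = x \/ z = y.
Proof.
move=> zx; have yx := esym (s_rel sxy).
have /mem_neq0[u uz] : z <> mset0.
  by move=> z0; apply: xN0; apply: fact_prod_eq0; rewrite -zx z0 fact_prod0.
case/orP: (s_supp u sxy) => [ux|uy].
  left; apply: (isolated (z' := y)) => //.
  exact: (shared_atom (u := u)).
right; apply: (isolated (z' := x)) => //.
- by move=> /E'_sym-/E'xy.
- by move=> v vy vx; exact: disjoint_xy vx vy.
- exact: (shared_atom (u := u)).
Qed.

(** A chain from [x] to [y] has no other factorizations to visit, so one of its steps goes directly
    from [x] to [y]; coprimality makes the length of this step the maximum of the two sizes. *)
Lemma generic_relation_catenary :
  enat_le (Fin (maxn (size x) (size y))) (catenary_degree S).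
Proof.
have /catenary_leP cP : enat_le (catenary_degree S) (catenary_degree S).
  by case: (catenary_degree S) => /=.
have [||k [w [w0 wk wx wd]]] := cP (repr (fact_prod x)) x y.
- by rewrite /factorizations /= coset_repr.
- by rewrite /factorizations /= coset_repr (s_rel sxy).
have wxy i : (i <= k)%N -> w i = x \/ w i = y.
  by move=> /wx; rewrite /factorizations /= coset_repr => /generic_relation_factorizations.
have [i ik [wi wSi]] : exists2 i, (i < k)%N & w i = x /\ w i.+1 = y.
  have : exists2 i, (i < k)%N & w i = x /\ w i.+1 <> x.
    apply: contrapT => nx; apply: xNy; rewrite -wk.
    suff wE : forall i, (i <= k)%N -> w i = x by rewrite wE.
    elim=> [//|i IHi ik]; apply: contrapT => wSi; apply: nx.
    by exists i => //; split=> //; apply: IHi; exact: ltnW.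
  by move=> [i ik [wi wSi]]; exists i => //; split=> //; case: (wxy i.+1 ik) => // /wSi.
by have := wd i ik; rewrite wi wSi dist_coprime ?generic_relation_coprime.
Qed.

End OneRelation.

Lemma generic_tame_le_catenary : enat_le (tame_degree S) (catenary_degree S).
Proof.
apply/tame_leP => u z y zE.
have [uz|uNz] := boolP (u \in z).
  exists (z `\ u); rewrite msetB1K // distxx.
  by case: (catenary_degree S).
have [[p [q [w [spq [wz|wz]]]]]|no_step] :=
  pselect (exists p q w, s (p, q) /\ (w `+` p = z \/ w `+` q = z)).
- have uq : u \in q.
    have := s_supp u spq; case/orP => // up.
    by move: uNz; rewrite -wz in_msetD up orbT.
  have uwq : u \in w `+` q by rewrite in_msetD uq orbT.
  exists ((w `+` q) `\ u); rewrite msetB1K //.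
    by rewrite -wz !fact_prodD (s_rel spq).
  rewrite -wz dist_msetDl; apply: enat_le_trans (generic_relation_catenary spq).
  exact: dist_le.
- have up : u \in p.
    have := s_supp u spq; case/orP => // uq.
    by move: uNz; rewrite -wz in_msetD uq orbT.
  have uwp : u \in w `+` p by rewrite in_msetD up orbT.
  exists ((w `+` p) `\ u); rewrite msetB1K //.
    by rewrite -wz !fact_prodD (s_rel spq).
  rewrite -wz dist_msetDl; apply: enat_le_trans (generic_relation_catenary spq).
  by rewrite maxnC; exact: dist_le.
(* No relation applies to [z], so [z] is its only factorization and would have to contain [u]. *)
- have yz : [mset u] `+` y = z.
    apply: (generated_isolated _ (s_gen zE)) => p q w spq.
    by split=> wz; apply: no_step; exists p, q, w; split=> //; [left|right].
  by move: uNz; rewrite -yz in_msetD in_mset1 eqxx.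
Qed.

End Generic.

(** * Operations on chains of factorizations *)

Section Chains.
Variable S : nmodType.
Implicit Types (a b : S) (x y z w : factorization S) (N : enat).

Lemma chain_connected_trans a N y x z :
  chain_connected a N x y -> chain_connected a N y z -> chain_connected a N x z.
Proof.
move=> [k [w [w0 wk wa wd]]] [l [v [v0 vl va vd]]].
(* The junction index [k] is read from [v], which is consistent because [w k] and [v 0] are both
   [y]. *)
exists (k + l)%N, (fun i => if (i < k)%N then w i else v (i - k)%N); split.
- case: ltnP => //; rewrite leqn0 => /eqP k0.
  by rewrite -w0 k0 subn0 v0 -wk k0.
- by rewrite ltnNge leq_addr /= addKn.
- move=> i ik; case: ltnP => [/ltnW/wa//|ki]; apply: va; lia.
- move=> i ik; case: (ltnP i k) => ki; last first.
    rewrite ltnNge (leq_trans ki) ?leqnSn //= subSn //; apply: vd; lia.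
  case: ltnP => Sik; first exact: wd.
  have ->: (i.+1 - k = 0)%N by lia.
  rewrite v0 -wk; have -> : k = i.+1 by lia.
  exact: wd.
Qed.

Lemma chain_connected1 a N x y : factorizations a x -> factorizations a y ->
  enat_le (Fin (dist x y)) N -> chain_connected a N x y.
Proof.
move=> ax ay xy; exists 1%N, (fun i => if i is 0 then x else y).
by split=> //; case.
Qed.

Lemma chain_connected_add a b N w x y :
  coset b = fact_prod w + coset a ->
  chain_connected a N x y -> chain_connected b N (w `+` x) (w `+` y).
Proof.
move=> bE [k [v [v0 vk va vd]]]; exists k, (fun i => w `+` v i); split.
- by rewrite v0.
- by rewrite vk.
- by move=> i /va vi; rewrite /factorizations /= fact_prodD vi bE.
- by move=> i /vd; rewrite dist_msetDl.
Qed.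

Lemma dist_sym x y : dist x y = dist y x.
Proof. by rewrite /dist msetIC maxnC. Qed.

Lemma chain_connected_sym a N x y : chain_connected a N x y -> chain_connected a N y x.
Proof.
move=> [k [w [w0 wk wa wd]]].
exists k, (fun i => w (k - i)%N); split; rewrite ?subn0 ?subnn // => i ik.
  by apply: wa; exact: leq_subr.
have -> : (k - i = (k - i.+1).+1)%N by lia.
by rewrite dist_sym; apply: wd; lia.
Qed.

End Chains.

(** * The omega invariant lies between the catenary and the tame degree *)

Section OmegaBounds.
Variables (S : nmodType) (S_cancel : cancellative S) (S_atomic : atomic S).
Implicit Types (a b : S) (u v : red_atom S) (x y z w : factorization S).

Lemma dist_eq0 z w : dist z w = 0%N -> z = w.
Proof.
move=> /eqP; rewrite /dist -leqn0 geq_max !leqn0 !size_mset_eq0 !msetB_eq0.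
by rewrite msubsetIidl msubsetIidr -eqEmsubset => /eqP.
Qed.

Let red_cancel := cancel_reduced S_cancel.

(** The invariant speaks of elements of [S]; it is applied to representatives of the atoms of [w],
    and the chosen indices select the submultiset [x]. *)
Lemma omega_le_divides N u w : enat_le (omega S) (Fin N) ->
  divides (val u) (fact_prod w) ->
  exists x, [/\ x `<=` w, (size x <= N)%N & divides (val u) (fact_prod x)].
Proof.
move=> /omega_leP oN uw.
have w0 : (0 < size w)%N.
  rewrite lt0n size_mset_eq0; apply/eqP => w0; move: uw; rewrite w0 fact_prod0.
  by move=> [c /esym uc]; have [Nu _] := red_atomP u; apply: Nu; exists c.
pose t := in_tuple w.
have wE : fact_prod w = \sum_(i < size w) val (tnth t i).
  by rewrite /fact_prod (big_tnth _ _ (w : seq _)).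
have [|//||Om sOm dOm] := oN (repr (val u)) (size w) (fun i => repr (val (tnth t i))).
- by apply/atom_coset; rewrite coset_repr; exact: red_atomP.
- apply/divides_coset; rewrite coset_sum coset_repr; move: uw; rewrite wE.
  by under [X in divides _ X -> _]eq_bigr do rewrite -[val _]coset_repr.
exists (seq_mset [seq tnth t i | i in Om]); split.
- apply/msubsetP => v; rewrite mset_seqE -count_mem_mset.
  apply: (@leq_trans (count_mem v [seq tnth t i | i <- fintype.enum 'I_(size w)])).
    by apply/leq_count_subseq/map_subseq; rewrite {1}enumT filter_subseq.
  by rewrite map_tnth_enum.
- by rewrite (perm_size (perm_eq_seq_mset _)) size_map -cardE.
- move: dOm; rewrite fact_prod_seq_mset big_image /= => /divides_coset.
  rewrite coset_sum coset_repr.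
  by under [X in divides _ X -> _]eq_bigr do rewrite coset_repr.
Qed.

(** Induction on the size of [z], treating one atom [u] of [z] at a time at a cost of at most [N]
    atoms of [w]. *)
Lemma omega_le_divides_fact_prod N z w : enat_le (omega S) (Fin N) ->
  divides (fact_prod z) (fact_prod w) ->
  exists x, [/\ x `<=` w, (size x <= N * size z)%N &
                divides (fact_prod z) (fact_prod x)].
Proof.
move=> oN; elim: {z}(size z) {-2}z (erefl (size z)) w => [|n IHn] z sz w zw.
  exists mset0; rewrite msub0set size_mset0; split=> //.
  by move/eqP: sz; rewrite size_mset_eq0 => /eqP->; exists 0; rewrite addr0.
have [z0|[u uz]] := mset_0Vmem z; first by move: sz; rewrite z0 size_mset0.
have sz1 : size (z `\ u) = n.
  by have := sz; rewrite -{1}(msetB1K uz) size_msetD size_mset1 => -[].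
have zE : fact_prod z = val u + fact_prod (z `\ u).
  by rewrite -fact_prod1 -fact_prodD msetB1K.
have [x1 [x1w sx1 [B x1B]]] : exists x,
    [/\ x `<=` w, (size x <= N)%N & divides (val u) (fact_prod x)].
  apply: omega_le_divides => //; apply: divides_trans zw.
  by exists (fact_prod (z `\ u)).
have [y yB] := atomic_reduced S_atomic B.
(* Once [u] is taken out of [x1], a factorization [y] of the cofactor remains available for the rest
   of [z]. Atoms of [x2] that come from [y] are already paid for by [x1], hence the witness [x1]
   plus [x2] without [y]. *)
have [|x2 [x2w sx2 zx2]] := IHn _ sz1 (y `+` (w `\` x1)).
  have [C wC] := zw; exists C; apply: (red_cancel (y := val u)).
  rewrite addrA -zE -wC fact_prodD addrA yB -x1B -fact_prodD msetBDKC //.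
exists (x1 `+` (x2 `\` y)); split.
- rewrite -(msetBDKC x1w) msetDS // subset_msetBLR; exact: x2w.
- rewrite size_msetD sz mulnS leq_add //; rewrite -sz1; apply: leq_trans sx2.
  by rewrite -[in leqRHS](msetBDK (msubsetDl x2 y)) size_msetD leq_addl.
- have x2y : x2 `<=` y `+` (x2 `\` y) by rewrite -subset_msetBLR msubset_refl.
  have [C CE] := divides_trans zx2 (msubset_divides x2y).
  exists C; rewrite fact_prodD x1B -yB -addrA -fact_prodD CE.
  by rewrite zE addrA.
Qed.

(** A part [x] of [w] with at most [N * size z] atoms already has a product divisible by that of
    [w]; by cancellation the rest of [w] has product [0], so it is empty. *)
Lemma omega_le_size N z w : enat_le (omega S) (Fin N) ->
  fact_prod z = fact_prod w -> (size w <= N * size z)%N.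
Proof.
move=> oN zw; have [|x [xw sx [C xC]]] := @omega_le_divides_fact_prod N z w oN.
  by exists 0; rewrite addr0.
suff w0 : w `\` x = mset0 by rewrite -(msetBDKC xw) w0 msetD0.
apply: fact_prod_eq0; apply: (@reduced_addI0 _ _ C).
apply: (red_cancel (y := fact_prod x)).
by rewrite addrA -fact_prodD msetBDKC // -zw -xC addr0.
Qed.

Lemma catenary_le_omega : enat_le (catenary_degree S) (omega S).
Proof.
case oE : (omega S) => [N|]; last exact: enat_le_Infty.
have oN : enat_le (omega S) (Fin N) by rewrite oE /=.
apply/catenary_leP => a z0.
(* The bound [M] on the lengths of all factorizations of [a] is the induction parameter;
   [omega_le_size] provides an initial value. *)
suff H M : forall a, (forall w, factorizations a w -> (size w <= M)%N) ->
    forall z z', factorizations a z -> factorizations a z' ->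
    chain_connected a (Fin N) z z'.
  move=> z0' az0; apply: (H (N * size z0)%N) => // w aw.
  by apply: omega_le_size oN _; rewrite az0 aw.
elim: M => [|M IHM] {}a aM z z' az az'.
  have z_0 y : factorizations a y -> y = mset0.
    by move=> /aM; rewrite leqn0 size_mset_eq0 => /eqP.
  by apply: chain_connected1 => //; rewrite (z_0 z) // (z_0 z') // distxx.
(* Removing a common atom [u] lowers the bound on the lengths by one, so the induction hypothesis
   connects what is left. *)
have shared u x y : factorizations a x -> factorizations a y ->
    u \in x -> u \in y -> chain_connected a (Fin N) x y.
  move=> ax ay ux uy; rewrite -(msetB1K ux) -(msetB1K uy).
  pose b := repr (fact_prod (x `\ u)).
  have bE : coset b = fact_prod (x `\ u) by rewrite coset_repr.
  have abE : coset a = fact_prod [mset u] + coset b.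
    by rewrite bE -fact_prodD msetB1K.
  apply: (chain_connected_add abE); apply: IHM => [w bw||].
  - have /aM : factorizations a ([mset u] `+` w).
      by rewrite /factorizations /= fact_prodD bw.
    by rewrite size_msetD size_mset1.
  - by rewrite /factorizations /= bE.
  - apply: (red_cancel (y := fact_prod [mset u])).
    by rewrite -abE -fact_prodD msetB1K.
(* As [x] has more than [N] atoms, some atom [u] lies outside the part [t] that [v] divides.
   Replacing [t] by [v] and [q] gives a factorization that shares [u] with [x] and [v] with [y]. *)
have long x y : factorizations a x -> factorizations a y -> (N < size x)%N ->
    chain_connected a (Fin N) x y.
  move=> ax ay Nx; have [y0|[v vy]] := mset_0Vmem y.
    have x0 : x = mset0 by apply: fact_prod_eq0; rewrite ax -ay y0 fact_prod0.
    by move: Nx; rewrite x0 size_mset0.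
  have [|t [tx st [B tB]]] := @omega_le_divides N v x oN.
    by rewrite ax -ay; exact: mem_divides.
  have [q qB] := atomic_reduced S_atomic B.
  have [xt0|[u uxt]] := mset_0Vmem (x `\` t).
    by move: Nx; rewrite -(msetBDKC tx) xt0 msetD0 ltnNge st.
  have am : factorizations a (([mset v] `+` q) `+` (x `\` t)).
    by rewrite /factorizations /= !fact_prodD fact_prod1 qB -tB -fact_prodD msetBDKC.
  apply: (@chain_connected_trans _ _ _ (([mset v] `+` q) `+` (x `\` t))).
    apply: (shared u) => //; first by apply: msubset_subset uxt; exact: msubsetDl.
    by rewrite in_msetD uxt orbT.
  by apply: (shared v) => //; rewrite !in_msetD in_mset1 eqxx.
have [Nz|zN] := ltnP N (size z); first exact: long.
have [Nz'|z'N] := ltnP N (size z'); last first.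
  by apply: chain_connected1 => //=; rewrite (leq_trans (dist_le _ _)) // geq_max zN.
by apply: chain_connected_sym; exact: long.
Qed.

Lemma omega_le_tame : (exists v, ~ prime_elt (val v)) ->
  enat_le (omega S) (tame_degree S).
Proof.
move=> [v vNp]; case tE : (tame_degree S) => [N|]; last exact: enat_le_Infty.
have tN : enat_le (tame_degree S) (Fin N) by rewrite tE /=.
have {}tN := proj1 (tame_leP _ _) tN.
(* Were [N] zero, every factorization of a multiple of [v] would contain [v], and [v] would be
   prime. *)
have N0 : (0 < N)%N.
  rewrite lt0n; apply/eqP => N0; apply: vNp; split.
    by have [] := red_atomP v.
  move=> A B [C ABC].
  have [zA zAE] := atomic_reduced S_atomic A.
  have [zB zBE] := atomic_reduced S_atomic B.
  have [zC zCE] := atomic_reduced S_atomic C.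
  have [|y _] := tN v (zA `+` zB) zC.
    by rewrite !fact_prodD fact_prod1 zAE zBE zCE.
  rewrite N0 /= leqn0 => /eqP/dist_eq0 zE.
  have : v \in zA `+` zB by rewrite zE in_msetD in_mset1 eqxx.
  rewrite in_msetD -zAE -zBE => /orP[] /mem_divides; first by left.
  by right.
apply/omega_leP => u n a au n0 /divides_coset.
rewrite coset_sum => -[C uC].
have [z zE] := choice (fun i => atomic_reduced S_atomic (coset (a i))).
have [zC zCE] := atomic_reduced S_atomic C.
have uP : `[< atom (coset u) >] by apply/asboolP/atom_coset.
pose U : red_atom S := exist _ (coset u) uP.
pose Z := \big[msetD/mset0]_i z i.
have ZE : fact_prod Z = \sum_i coset (a i).
  by rewrite fact_prod_big; apply: eq_bigr.
have [|y yE yN] := tN U Z zC; first by rewrite fact_prodD fact_prod1 zCE ZE uC.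
have [g [p [q [ZgE yg pq]]]] := msetI_split Z ([mset U] `+` y).
(* Each atom of [x] is charged to one [z i] containing it, so at most [size x] of the elements [a i]
   are needed. *)
have cover (x : factorization S) : divides (coset u) (fact_prod x) ->
    x `<=` Z -> (size x <= N)%N ->
    exists2 Om : {set 'I_n}, enat_le (Fin #|Om|) (Fin N) &
      divides u (\sum_(i in Om) a i).
  move=> ux xZ xN; have [Om sOm xOm] := msubset_big_cover xZ.
  exists Om; first exact: leq_trans sOm xN.
  apply/divides_coset; apply: divides_trans ux _; rewrite coset_sum.
  have := msubset_divides xOm; rewrite fact_prod_big.
  by under [X in divides _ X -> _]eq_bigr do rewrite zE.
(* If [U] is in the gcd, it occurs in [Z] and alone suffices, which takes [0 < N]. Otherwise [U] is
   in [q], and the removed part [p] has the same product as [q]. *)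
have [Ug|UNg] := boolP (U \in g).
  apply: (cover [mset U]); rewrite ?size_mset1 //.
    by rewrite fact_prod1; exists 0; rewrite addr0.
  by rewrite msub1set ZgE in_msetD Ug.
apply: (cover p).
- have -> : fact_prod p = fact_prod q.
    apply: (red_cancel (y := fact_prod g)).
    by rewrite -!fact_prodD -ZgE -yg.
  have Uq : U \in q.
    have : U \in g `+` q by rewrite -yg in_msetD in_mset1 eqxx.
    by rewrite in_msetD (negPf UNg).
  exact: (mem_divides Uq).
- by rewrite ZgE -[X in X `<=` _]mset0D msetSD // msub0set.
- by move: yN; rewrite ZgE yg dist_msetDl dist_coprime //= geq_max => /andP[].
Qed.

End OmegaBounds.

(** * Divisor-closed embeddings of reduced monoids and the invariants along them *)

Definition divisor_closed_embedding (X Y : nmodType) (g : X -> Y) : Prop :=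
  [/\ g 0 = 0, {morph g : a b / a + b}, injective g &
      forall a b, divides b (g a) -> exists b', b = g b'].

Lemma divisor_closed_embedding_comp (X Y Z : nmodType) (h : Y -> Z) (g : X -> Y) :
  divisor_closed_embedding h -> divisor_closed_embedding g ->
  divisor_closed_embedding (h \o g).
Proof.
move=> [h0 hD hI hdiv] [g0 gD gI gdiv]; split=> [|a b||a b] /=.
- by rewrite g0.
- by rewrite gD hD.
- exact: inj_comp.
- move=> /[dup] /hdiv[b' ->] [c E].
  have [c' cE] : exists c', c = h c'.
    by apply: (hdiv (g a)); exists (h b'); rewrite addrC.
  have [|b'' ->] := gdiv a b'; last by exists b''.
  by exists c'; apply: hI; rewrite hD -cE.
Qed.

Section ReducedMap.
Variables (H S : nmodType) (f : H -> S).
Hypotheses (f0 : f 0 = 0) (fD : {morph f : a b / a + b}).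
Hypothesis f_assoc : forall a b, associated (f a) (f b) -> associated a b.
Hypothesis f_div : forall a b, divides b (f a) -> exists b', associated b (f b').

Definition reduced_map (A : reduced H) : reduced S := coset (f (repr A)).

Lemma reduced_map_coset a : reduced_map (coset a) = coset (f a).
Proof.
have /cosetP[u [v uv] E] : coset a = coset (repr (coset a)) by rewrite coset_repr.
apply/esym/cosetP; exists (f u); last by rewrite -fD -E.
by exists (f v); rewrite -fD uv f0.
Qed.

(** The hypotheses on [f] hold only up to units; passing to cosets turns them into injectivity and
    closure under divisors. *)
Lemma reduced_map_embedding : divisor_closed_embedding reduced_map.
Proof.
split=> [|A B|A B|A B].
- by rewrite -coset0 reduced_map_coset f0.
- rewrite -(coset_repr A) -(coset_repr B) -cosetD !reduced_map_coset.
  by rewrite fD cosetD.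
- rewrite -(coset_repr A) -(coset_repr B) !reduced_map_coset => /cosetP/f_assoc.
  by move=> /cosetP.
- rewrite -(coset_repr A) -(coset_repr B) reduced_map_coset.
  move=> /divides_coset/f_div[b' bb']; exists (coset b').
  by rewrite reduced_map_coset; apply/cosetP.
Qed.

End ReducedMap.

Section Transfer.
Variables (H S : nmodType) (g : reduced H -> reduced S).
Hypothesis g_embed : divisor_closed_embedding g.
Implicit Types (u : red_atom H) (x y z : factorization H).

Let g0 : g 0 = 0. Proof. by case: g_embed. Qed.
Let gD : {morph g : A B / A + B}. Proof. by case: g_embed. Qed.
Let gI : injective g. Proof. by case: g_embed. Qed.
Let gdiv A B : divides B (g A) -> exists B', B = g B'.
Proof. by case: g_embed => _ _ _; apply. Qed.

Lemma atom_embedding A : atom (g A) <-> atom A.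
Proof.
split=> -[Nu aP]; split.
- move=> /units_reduced A0; apply: Nu; rewrite A0 g0; exact: units0.
- move=> B C ABC; case: (aP (g B) (g C)); first by rewrite ABC gD.
  + by move=> /units_reduced; rewrite -g0 => /gI ->; left; exact: units0.
  + by move=> /units_reduced; rewrite -g0 => /gI ->; right; exact: units0.
- by move=> /units_reduced; rewrite -g0 => /gI A0; apply: Nu; rewrite A0; exact: units0.
- move=> B C ABC.
  have [B' BE] : exists B', B = g B' by apply: (gdiv (A := A)); exists C.
  have [C' CE] : exists C', C = g C'.
    by apply: (gdiv (A := A)); exists B; rewrite addrC.
  rewrite BE CE; case: (aP B' C'); first by apply: gI; rewrite gD ABC BE CE.
  + by move=> /units_reduced ->; rewrite g0; left; exact: units0.
  + by move=> /units_reduced ->; rewrite g0; right; exact: units0.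
Qed.

Lemma red_atom_map_proof u : `[< atom (g (val u)) >].
Proof. by apply/asboolP/atom_embedding; exact: red_atomP. Qed.

Definition red_atom_map u : red_atom S := exist _ (g (val u)) (red_atom_map_proof u).

Lemma red_atom_map_inj : injective red_atom_map.
Proof. by move=> u v /(congr1 val)/= /gI/val_inj. Qed.

Definition fact_map z : factorization S := seq_mset [seq red_atom_map u | u <- z].

Lemma fact_map_seq_mset (s : seq (red_atom H)) :
  fact_map (seq_mset s) = seq_mset [seq red_atom_map u | u <- s].
Proof. by apply/eq_seq_msetP; rewrite perm_map // perm_eq_seq_mset. Qed.

Lemma fact_map1 u : fact_map [mset u] = [mset (red_atom_map u)].
Proof. by rewrite /fact_map enum_msetn /= -[RHS]seq_mset_id enum_msetn. Qed.

Lemma fact_mapD x y : fact_map (x `+` y) = fact_map x `+` fact_map y.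
Proof.
rewrite /fact_map -seq_mset_cat -map_cat; apply/eq_seq_msetP/perm_map.
exact: perm_msetD.
Qed.

Lemma size_fact_map z : size (fact_map z) = size z.
Proof. by rewrite (perm_size (perm_eq_seq_mset _)) size_map. Qed.

Lemma fact_prod_map z : fact_prod (fact_map z) = g (fact_prod z).
Proof.
rewrite fact_prod_seq_mset big_map /fact_prod.
by rewrite (big_morph g gD g0).
Qed.

Lemma fact_map_inj : injective fact_map.
Proof.
move=> x y /eq_seq_msetP/(perm_map_inj red_atom_map_inj)/eq_seq_msetP.
by rewrite !seq_mset_id.
Qed.

Lemma dist_fact_map x y : dist (fact_map x) (fact_map y) = dist x y.
Proof.
have [c [p [q [-> -> pq]]]] := msetI_split x y.
rewrite !fact_mapD !dist_msetDl !dist_coprime ?size_fact_map //.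
have [//|[v]] := mset_0Vmem (fact_map p `&` fact_map q).
rewrite in_msetI !mem_seq_mset => /andP[/mapP[u up ->] /mapP[u' uq]].
move=> /red_atom_map_inj uu'; have : u \in p `&` q by rewrite in_msetI up uu'.
by rewrite pq in_mset0.
Qed.

(** Every atom of [w] divides [g A], so it is the image of an element, which is an atom by
    [atom_embedding]. *)
Lemma fact_map_lift A (w : factorization S) :
  fact_prod w = g A -> exists2 z, w = fact_map z & fact_prod z = A.
Proof.
move=> wA; have wg (v : red_atom S) : v \in w -> exists u, v = red_atom_map u.
  move=> /mem_divides; rewrite wA => /gdiv[B vB].
  have aB : atom B by apply/atom_embedding; rewrite -vB; exact: red_atomP.
  by exists (exist _ B (asboolT aB)); apply: val_inj.
have [s sw] : exists s, seq_mset w = seq_mset [seq red_atom_map u | u <- s].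
  suff lift (t : seq (red_atom S)) : {subset t <= w} ->
      exists s, seq_mset t = seq_mset [seq red_atom_map u | u <- s] by exact: lift.
  elim: t => [|v t IHt] tw; first by exists [::].
  have [|u vu] := wg v; first by apply: tw; rewrite mem_head.
  have [|s ts] := IHt; first by move=> r rt; apply: tw; rewrite inE rt orbT.
  by exists (u :: s); rewrite /= !mset_cons vu ts.
have wE : w = fact_map (seq_mset s) by rewrite fact_map_seq_mset -sw seq_mset_id.
by exists (seq_mset s) => //; apply: gI; rewrite -fact_prod_map -wE.
Qed.

Lemma catenary_embedding : enat_le (catenary_degree H) (catenary_degree S).
Proof.
have cS : enat_le (catenary_degree S) (catenary_degree S).
  by case: (catenary_degree S) => /=.
have {}cS := proj1 (catenary_leP _ _) cS.
apply/catenary_leP => a z z' az az'.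
pose b := repr (g (coset a)).
have bE : coset b = g (coset a) by rewrite coset_repr.
have [||k [w [w0 wk wb wd]]] := cS b (fact_map z) (fact_map z').
- by rewrite /factorizations /= fact_prod_map az bE.
- by rewrite /factorizations /= fact_prod_map az' bE.
(* Beyond [k] nothing is required; [z] is a default value that makes [choice] applicable. *)
have vex i : exists v, (i <= k)%N -> w i = fact_map v /\ fact_prod v = coset a.
  have [ik|] := leqP i k; last by exists z.
  have [|y wy ya] := @fact_map_lift (coset a) (w i); last by exists y.
  by rewrite -bE; exact: wb.
have [v vE] := choice vex.
have v0 : v 0%N = z by apply: fact_map_inj; rewrite -(vE 0%N _).1 ?w0.
have vk : v k = z' by apply: fact_map_inj; rewrite -(vE k _).1 ?wk.
exists k, v; split=> // i ik; first by case: (vE i ik).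
have [[wi _] [wSi _]] := (vE i (ltnW ik), vE i.+1 ik).
by have := wd i ik; rewrite wi wSi dist_fact_map.
Qed.

(** The prime atoms of [z] stay in place. The others have a product in the image of [g], so the tame
    move can be made in [H] and carried back. *)
Lemma tame_embedding : cancellative S -> atomic S ->
  (forall A, (forall p, prime_elt p -> ~ divides p A) -> exists A', A = g A') ->
  enat_le (tame_degree S) (tame_degree H).
Proof.
move=> S_cancel S_atomic g_primefree.
have tH : enat_le (tame_degree H) (tame_degree H).
  by case: (tame_degree H) => /=.
have {}tH := proj1 (tame_leP _ _) tH.
apply/tame_leP => u z y zE.
have uz : divides (val u) (fact_prod z).
  by exists (fact_prod y); rewrite zE fact_prodD fact_prod1.
(* A prime atom [u] divides an atom of [z], hence equals it: [z] needs no change. *)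
have [up|uNp] := pselect (prime_elt (val u)).
  have [v vz /red_atom_divides uv] := prime_divides_fact_prod up uz.
  rewrite -uv in vz; exists (z `\ u); rewrite msetB1K // distxx.
  by case: (tame_degree H).
pose isp (v : red_atom S) := `[< prime_elt (val v) >].
pose z1 := seq_mset [seq v <- z | isp v].
pose z2 := seq_mset [seq v <- z | ~~ isp v].
have zz : z = z1 `+` z2.
  rewrite -seq_mset_cat -[LHS]seq_mset_id; apply/eq_seq_msetP.
  by rewrite perm_sym; apply/permEl/perm_filterC.
(* The primes of [z1] are stripped one by one: such a [p] differs from the nonprime atom [u], so it
   divides the cofactor of [u] and can be cancelled. *)
have [B z2B] : divides (val u) (fact_prod z2).
  move: uz; rewrite zz fact_prodD fact_prod_seq_mset.
  have : all isp [seq v <- z | isp v] by exact: filter_all.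
  elim: [seq v <- z | isp v] => [|p s IHs] /=; first by rewrite big_nil add0r.
  move=> /andP[/asboolP pp sp]; rewrite big_cons => -[C CE]; apply: IHs => //.
  have [|[] pC] : divides (val p) (val u) \/ divides (val p) C.
  - by case: pp => _; apply; rewrite -CE -addrA; eexists.
  - by move=> /red_atom_divides pu; case: uNp; rewrite -pu.
  - move=> E; exists pC; apply: (cancel_reduced S_cancel (y := val p)).
    by rewrite addrA CE E addrCA.
(* A prime dividing this product would divide, hence equal, an atom of [z2], none of which is
   prime. *)
have [C z2C] : exists C, fact_prod z2 = g C.
  apply: g_primefree => p pp /(prime_divides_fact_prod pp)[v].
  rewrite mem_seq_mset mem_filter => /andP[/asboolPn vNp _].
  move=> [c vE]; have [_ /(_ _ _ vE)[pu|/units_reduced c0]] := red_atomP v.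
    by case: pp.
  by apply: vNp; rewrite vE c0 addr0.
have [x2 z2x x2C] := fact_map_lift z2C.
have [y2 y2B] := atomic_reduced S_atomic B.
(* Lifting a second factorization of [g C], one that contains [u], shows that [u] is the image of an
   atom [u'] of [H]. *)
have [|x x2E xC] := @fact_map_lift C ([mset u] `+` y2).
  by rewrite fact_prodD fact_prod1 y2B -z2C z2B.
have : u \in fact_map x by rewrite -x2E in_msetD in_mset1 eqxx.
rewrite mem_seq_mset => /mapP[u' u'x uu'].
have [|y' y'E y'd] := tH u' x2 (x `\ u'); first by rewrite msetB1K // xC.
have moveE : [mset u] `+` (z1 `+` fact_map y') = z1 `+` fact_map ([mset u'] `+` y').
  by rewrite msetDCA fact_mapD fact_map1 -uu'.
exists (z1 `+` fact_map y'); rewrite moveE zz z2x.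
  by rewrite !fact_prodD !fact_prod_map y'E.
by rewrite dist_msetDl dist_fact_map.
Qed.

End Transfer.

(** * A component of a coproduct *)

Section CoproductComponent.
Variables (T : nmodType) (I : Type) (T_ : I -> nmodType) (i0 : I).

(** The type [I] has no decidable equality, so the index is compared classically and [a] is
    transported along the resulting equation. *)
Definition single (a : T_ i0) (i : I) : T_ i :=
  if pselect (i0 = i) is left e then eq_rect i0 T_ a i e else 0.

Lemma single_eq a : single a i0 = a.
Proof.
rewrite /single; case: pselect => // e.
by rewrite (Prop_irrelevance e erefl).
Qed.

Lemma single_neq a i : i0 <> i -> single a i = 0.
Proof. by rewrite /single; case: pselect. Qed.

Lemma coproduct_single a : coproduct T_ (single a).
Proof.
apply: (@sub_finite_set _ _ [set i0]); last exact: finite_set1.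
by move=> i /=; have [<-|/single_neq->] := pselect (i0 = i).
Qed.

(** A divisor of an element concentrated at [i0] can be nonzero elsewhere, but only by units; hence
    the embedding lives on the reduced monoids. *)
Lemma coproduct_component_embedding : is_coproduct T T_ ->
  exists g : reduced (T_ i0) -> reduced T, divisor_closed_embedding g.
Proof.
move=> [phi [phi0 phiD phiI phiR]].
have phi_surj h : coproduct T_ h -> exists t, phi t = h.
  by rewrite -phiR => -[t _ <-]; exists t.
have [f fE] := choice (fun a => phi_surj _ (coproduct_single a)).
have phi_ext s t : (forall i, phi s i = phi t i) -> s = t.
  by move=> st; apply/phiI/functional_extensionality_dep.
have f0 : f 0 = 0.
  apply: phi_ext => i; rewrite fE phi0.
  by have [<-|/single_neq->//] := pselect (i0 = i); rewrite single_eq.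
have fD : {morph f : a b / a + b}.
  move=> a b; apply: phi_ext => i; rewrite phiD !fE.
  have [<-|ni] := pselect (i0 = i); first by rewrite !single_eq.
  by rewrite !single_neq // addr0.
exists (reduced_map f); apply: reduced_map_embedding => // a b.
  move=> [u [v uv] /(congr1 (phi^~ i0))]; rewrite phiD !fE !single_eq => ->.
  by exists (phi u i0) => //; exists (phi v i0); rewrite -phiD uv phi0.
move=> [c fa]; exists (phi b i0).
(* The part of [t] away from [i0]. For [b] and its cofactor [c] these parts add up to [0], since
   [f a] vanishes there; so both are units. *)
have rest t : exists w, forall i, phi w i = if pselect (i0 = i) then 0 else phi t i.
  have [|w wE] := phi_surj (fun i => if pselect (i0 = i) then 0 else phi t i).
    have : coproduct T_ (phi t) by rewrite -phiR; exists t.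
    by apply: sub_finite_set => i /=; case: pselect.
  by exists w => i; rewrite wE.
have [[w wE] [w' w'E]] := (rest b, rest c).
have ww' : w + w' = 0.
  apply: phi_ext => i; rewrite phi0 phiD wE w'E; case: pselect => [e|ni] /=.
    by rewrite addr0.
  by rewrite -phiD -fa fE single_neq.
exists w'; first by exists w; rewrite addrC.
have bE : b = f (phi b i0) + w.
  apply: phi_ext => i; rewrite phiD fE wE; case: pselect => [e|ni] /=.
    by case: _ / e; rewrite single_eq addr0.
  by rewrite single_neq // add0r.
by rewrite [in RHS]bE -addrA ww' addr0.
Qed.

End CoproductComponent.

(** * The prime-free submonoid *)

Section PrimeFreePart.
Variables (S : nmodType) (P : set S) (hP : prime_representatives P).
Let T := prime_free hP.

Lemma units_divides_units (a b : S) : units S a -> divides b a -> units S b.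
Proof. by move=> [v av] [c aE]; exists (c + v); rewrite addrA -aE. Qed.

Lemma unit_prime_free (u : S) : units S u -> prime_free_pred hP u.
Proof.
move=> uu; apply/asboolP => p Pp /(units_divides_units uu) pu.
by have [] := proj1 hP p Pp.
Qed.

Lemma units_prime_free (a : T) : units S (val a) -> units T a.
Proof.
move=> [v av]; have vu : units S v by exists (val a); rewrite addrC.
by exists (PrimeFree (unit_prime_free vu)); apply: val_inj.
Qed.

Lemma prime_free_embedding : exists2 g : reduced T -> reduced S,
  divisor_closed_embedding g &
  forall A, (forall p, prime_elt p -> ~ divides p A) -> exists A', A = g A'.
Proof.
pose f (a : T) : S := val a.
have fembed : divisor_closed_embedding (reduced_map f).
  apply: reduced_map_embedding => // a b.
    (* The unit relating two prime-free elements is itself prime-free, and so is its inverse; thus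
       associatedness in [S] descends to [T]. *)
    move=> [u uu bE]; exists (PrimeFree (unit_prime_free uu)); last exact: val_inj.
    exact: units_prime_free.
  move=> ba; have bT : prime_free_pred hP b.
    apply/asboolP => p Pp pb; have /asboolP/(_ p Pp) := prime_free_valP a; apply.
    exact: divides_trans pb ba.
  by exists (PrimeFree bT); apply/cosetP.
exists (reduced_map f) => // A Ap.
have aT : prime_free_pred hP (repr A).
  apply/asboolP => p Pp pA; apply: (Ap (coset p)).
    by apply/prime_coset; exact: (proj1 hP).
  by rewrite -(coset_repr A); apply/divides_coset.
exists (coset (PrimeFree aT)); rewrite reduced_map_coset //.
by rewrite -[LHS]coset_repr.
Qed.

(** Any atom [v] in a factorization of a nonunit of [T] will do: if [v] were prime, its
    representative in [P] would divide that element. *)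
Lemma exists_nonprime_atom : atomic S -> [set: T] <> units T ->
  exists v : red_atom S, ~ prime_elt (val v).
Proof.
move=> S_atomic TN; have [a aNu] : exists a : T, ~ units T a.
  apply: contrapT => all_u; apply: TN; apply/seteqP; split=> // a _.
  by apply: contrapT => aNu; apply: all_u; exists a.
have [z za] := S_atomic (val a).
have [z0|[v vz]] := mset_0Vmem z.
  case: aNu; apply: units_prime_free; apply/coset_eq0.
  by rewrite -za z0 fact_prod0.
exists v => vp; have := vp; rewrite -(coset_repr (val v)) => /prime_coset.
move=> /(proj2 hP)[p [[Pp /cosetP]]]; rewrite coset_repr => pv _.
have /asboolP/(_ p Pp) := prime_free_valP a; apply.
by apply/divides_coset; rewrite -za pv; exact: mem_divides.
Qed.

End PrimeFreePart.

Theorem theorem5p6 (S : nmodType) (S_cancel : cancellative S)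
  (S_atomic : atomic S)
  (P : set S) (hP : prime_representatives P)
  (I : Type) (T_ : I -> nmodType)
  (T_cancel : forall i, cancellative (T_ i))
  (T_coprod : is_coproduct (prime_free hP) T_)
  (T_nonunit : [set: prime_free hP] <> units (prime_free hP))
  (i_star : I)
  (T_generic : has_generic_presentation (T_ i_star))
  (T_tame : tame_degree (T_ i_star) = tame_degree (prime_free hP)) :
  catenary_degree S = omega S /\ omega S = tame_degree S.
Proof.
have c_le_o := catenary_le_omega S_cancel S_atomic.
have o_le_t : enat_le (omega S) (tame_degree S).
  exact: omega_le_tame (exists_nonprime_atom S_atomic T_nonunit).
have t_le_c : enat_le (tame_degree S) (catenary_degree S).
  have [g g_embed g_primefree] := prime_free_embedding hP.
  (* The tame degrees are compared along [g] alone, the catenary degrees along [g] after [h]. *)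
  have [h h_embed] := coproduct_component_embedding i_star T_coprod.
  have [s s_generic] := T_generic.
  apply: enat_le_trans (tame_embedding g_embed S_cancel S_atomic g_primefree) _.
  rewrite -T_tame; apply: enat_le_trans (generic_tame_le_catenary _ s_generic) _.
    exact: T_cancel.
  exact: catenary_embedding (divisor_closed_embedding_comp g_embed h_embed).
split; apply: enat_le_anti => //.
- exact: enat_le_trans o_le_t t_le_c.
- exact: enat_le_trans t_le_c c_le_o.
Qed.
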